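(* Let $m,n\ge1$. Let $B\in\mathbb R_{\ge0}^{m\times(mn)}$, with columns indexed by $(i,j)\in[m]\times[n]$, be a block diagonal matrix where each block consists of a single row, i.e. $B_{i,(i',j)}=0$ whenever $i\neq i'$. Consider the program $\min_{x\in\mathcal X}u^TBx$ under interval uncertainty $u_i\in[\overline u_i,\overline u_i+\Delta u_i]\subseteq\mathbb R_{\ge0}$ for all $i\in[m]$, where $$\mathcal X\subseteq\Big\{x\in\{0,1\}^{[m]\times[n]}:\ \sum_{j\in[n]}x_{i,j}=1\ \ \forall i\in[m]\Big\}.$$ Let $\Gamma\in[m]$. Then the $\Gamma$-counterpart of this program is equivalent to $$\min_{(k,l)\in([m]\times[n])\cup\{(0,0)\}}\Big\{\Gamma\,\Delta u_k\,B_{k,(k,l)}+\min_{x\in\mathcal X}\Big\{\overline u^TBx+\sum_{(i,j)\in[m]\times[n]}F_{i,j,k,l}(x)\Big\}\Big\},$$ where $B_{0,\cdot}:=0$, $\Delta u_0:=0$ (so $\Delta u_0B_{0,(0,0)}=0$) and $$F_{i,j,k,l}(x):=\max\{0,\ \Delta u_iB_{i,(i,j)}-\Delta u_kB_{k,(k,l)}\}\,x_{i,j}.$$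
   Context: Notation: $[m]:=\{1,\dots,m\}$. Let $\overline u=(\overline u_i)_{i\in[m]}$, and let $B_{i,\cdot}$ denote the $i$-th row of $B$. The $\Gamma$-counterpart of $\min_{x\in\mathcal X}u^TBx$ is taken with respect to the $m$ uncertain functions $f_i(x,u_i)=u_iB_{i,\cdot}x$ with nominal scenario $\overline u_i$, i.e. it is $$\min_{x\in\mathcal X}\ \max_{\mathcal S\subseteq[m]:|\mathcal S|\le\Gamma}\Big\{\sum_{i\in\mathcal S}\max_{u_i\in[\overline u_i,\overline u_i+\Delta u_i]}u_iB_{i,\cdot}x+\sum_{i\in[m]\setminus\mathcal S}\overline u_iB_{i,\cdot}x\Big\}.$$ Two minimization programs in $x$ (possibly with further auxiliary variables or indices) are called equivalent if they have the same optimal value in $[-\infty,\infty]$ and, whenever this value is finite, a point $x\in\mathcal X$ attains it in one program (for a suitable choice of the auxiliary variables or indices) if and only if it does so in the other. A minimum over the empty set is $+\infty$. *)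

(* Defs.v *)
From HB Require Import structures.
From mathcomp Require Import all_boot all_order all_algebra.
From mathcomp Require Import all_classical all_reals all_analysis.

Set Implicit Arguments.
Unset Strict Implicit.
Unset Printing Implicit Defensive.

Import Order.TTheory GRing.Theory Num.Theory.

Local Open Scope classical_set_scope.
Local Open Scope ring_scope.

(* [attained_at x] says that [x] reaches [opt_value] for some choice of the
   auxiliary indices; it is only meaningful for [x] in the feasible set. *)
Record min_program (R : realType) (T : Type) := MinProgram {
  opt_value : \bar R;
  attained_at : T -> Prop
}.

(* min_(x in X) f x; the unit +oo gives the convention min(empty) = +oo *)
Definition program (R : realType) (T : finType) (X : {set T})
    (f : T -> \bar R) : min_program R T :=
  let v := (\big[mine/+oo]_(x in X) f x)%E in
  MinProgram v (fun x => f x = v).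

(* min_k { c k + min_(x in X) g k x } *)
Definition indexed_program (R : realType) (T K : finType) (X : {set T})
    (c : K -> \bar R) (g : K -> T -> \bar R) : min_program R T :=
  let v := (\big[mine/+oo]_(k : K) (c k + \big[mine/+oo]_(x in X) g k x))%E in
  MinProgram v (fun x => exists k : K, (c k + g k x)%E = v).

Definition equivalent (R : realType) (T : finType) (X : {set T})
    (P Q : min_program R T) : Prop :=
  opt_value P = opt_value Q /\
  (opt_value P \is a fin_num ->
   forall x, x \in X -> attained_at P x <-> attained_at Q x).

Definition gamma_objective (R : realType) (T : Type) (m : nat)
    (f : 'I_m -> T -> R -> R) (ubar du : 'cV[R]_m) (Gamma : nat) (x : T)
    : \bar R :=
  (\big[maxe/-oo]_(S : {set 'I_m} | (#|S| <= Gamma)%N)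
     (\sum_(i in S) ereal_sup
        [set (f i x u)%:E | u in `[ubar i ord0, (ubar i ord0 + du i ord0)%R]]
      + \sum_(i in ~: S) (f i x (ubar i ord0))%:E))%E.

Definition gamma_counterpart (R : realType) (T : finType) (X : {set T})
    (m : nat) (f : 'I_m -> T -> R -> R) (ubar du : 'cV[R]_m) (Gamma : nat)
    : min_program R T :=
  program X (gamma_objective f ubar du Gamma).

(* The 0/1 array x as a real column vector; as everywhere below, the pair
   (i, j) is encoded as the column index [mxvec_index i j]. *)
Definition colvec (R : realType) (m n : nat) (x : 'M[bool]_(m, n))
    : 'cV[R]_(m * n) :=
  (mxvec (map_mx (fun b : bool => b%:R) x))^T.

Definition uncertain_fun (R : realType) (m n : nat) (B : 'M[R]_(m, m * n))
    (i : 'I_m) (x : 'M[bool]_(m, n)) (u : R) : R :=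
  u * (row i B *m colvec R x) ord0 ord0.

(* Delta u_k * B_(k,(k,l)); [None] is the extra index (0,0). *)
Definition threshold (R : realType) (m n : nat) (B : 'M[R]_(m, m * n))
    (du : 'cV[R]_m) (kl : option ('I_m * 'I_n)) : R :=
  if kl is Some (k, l) then du k ord0 * B k (mxvec_index k l) else 0.

Definition F (R : realType) (m n : nat) (B : 'M[R]_(m, m * n))
    (du : 'cV[R]_m) (i : 'I_m) (j : 'I_n) (kl : option ('I_m * 'I_n))
    (x : 'M[bool]_(m, n)) : R :=
  Num.max 0 (du i ord0 * B i (mxvec_index i j) - threshold B du kl)
  * (x i j)%:R.

Definition reformulation (R : realType) (m n : nat) (B : 'M[R]_(m, m * n))
    (ubar du : 'cV[R]_m) (Gamma : nat) (X : {set 'M[bool]_(m, n)})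
    : min_program R 'M[bool]_(m, n) :=
  indexed_program X
    (fun kl : option ('I_m * 'I_n) => (Gamma%:R * threshold B du kl)%:E)
    (fun kl x => ((ubar^T *m B *m colvec R x) ord0 ord0
                  + \sum_(ij : 'I_m * 'I_n) F B du ij.1 ij.2 kl x)%:E).

(* Main.v *)
Require Import Defs.
From HB Require Import structures.
From mathcomp Require Import all_boot all_order all_algebra.
From mathcomp Require Import all_classical all_reals all_analysis.

(** On a feasible [x] every row [i] selects exactly one column [j i], so the
    [i]-th uncertain function is [u * b i] with [b i = B_(i,(i,j i)) >= 0].
    Its worst case over the interval is reached at the upper end point, and the
    robust objective is the nominal cost plus the largest sum of at most
    [Gamma] of the deviations [d i = du_i * b i].

    Such a largest sum is the minimum over [t >= 0] of
    [Gamma * t + \sum_i max 0 (d i - t)].  Every [t >= 0] gives an upper bound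
    ([sum_le_threshold]); the bound is tight when [t] is a [Gamma]-th largest
    deviation, since then [t] separates [Gamma] largest deviations from the
    others ([separating_subset], [sum_eq_threshold]).  That [t] is some [d k],
    hence the threshold of the index pair [(k, j k)]: the finitely many
    thresholds of the reformulation contain an optimal one for every [x].

    So the robust objective is, pointwise on the feasible set, the attained
    minimum over the index pairs of the objectives of the reformulation.
    Exchanging this minimum with the one over [x] gives the equivalence
    ([equivalent_indexed_program]). *)

Set Implicit Arguments.
Unset Strict Implicit.
Unset Printing Implicit Defensive.

Import Order.TTheory GRing.Theory Num.Theory.

Local Open Scope classical_set_scope.
Local Open Scope ring_scope.

(** Weak duality: each [d i] is at most [t] plus the positive part of [d i - t].
    Padding [#|S|] up to [n] copies of [t] is where [0 <= t] enters. *)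
Lemma sum_le_threshold (R : realDomainType) (T : finType) (d : T -> R)
    (S : {set T}) (n : nat) (t : R) :
  0 <= t -> (#|S| <= n)%N ->
  \sum_(i in S) d i <= n%:R * t + \sum_i Num.max 0 (d i - t).
Proof.
move=> t_ge0 leSn.
have le_d i : d i <= t + Num.max 0 (d i - t).
  by rewrite -lerBlDl le_max lexx orbT.
apply: le_trans (ler_sum _ (fun i _ => le_d i)) _.
rewrite big_split sumr_const -[t *+ _]mulr_natl lerD //.
  by rewrite ler_wpM2r // ler_nat.
rewrite [leRHS](bigID (mem S)) lerDl sumr_ge0 // => i _.
by rewrite le_max lexx.
Qed.

(** Complementary slackness: the positive parts of [d i - t] vanish outside of
    [S], and are [d i - t] itself in [S]. *)
Lemma sum_eq_threshold (R : realDomainType) (T : finType) (d : T -> R)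
    (S : {set T}) (t : R) :
  (forall i, i \in S -> t <= d i) -> (forall i, i \notin S -> d i <= t) ->
  \sum_(i in S) d i = #|S|%:R * t + \sum_i Num.max 0 (d i - t).
Proof.
move=> inS notinS.
rewrite [X in _ + X](bigID (mem S)) /= [X in _ + (_ + X)]big1 ?addr0; last first.
  by move=> i /notinS le_dt; apply/max_idPl; rewrite subr_le0.
rewrite mulr_natl -sumr_const -big_split; apply: eq_bigr => i /inS le_td.
by rewrite (max_idPr _) ?subr_ge0 //= addrC subrK.
Qed.

(** Greedy selection: adding a largest element of the complement keeps the set
    separated from its complement, and that element becomes the separator. *)
Lemma separating_subset (disp : Order.disp_t) (R : orderType disp)
    (T : finType) (d : T -> R) (n : nat) :
  (n < #|T|)%N ->
  exists (S : {set T}) (k : T), [/\ #|S| = n.+1,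
    forall i, i \in S -> (d k <= d i)%O &
    forall i, i \notin S -> (d i <= d k)%O].
Proof.
elim: n => [|n IHn] lt_nT.
  have [k0 _] := card_gt0P lt_nT.
  case: (@arg_maxP _ _ _ k0 predT d isT) => k _ kmax.
  exists [set k]%SET, k; split=> [|i /set1P->|i _]; rewrite ?cards1 //.
  exact: kmax.
have [S [k [cardS inS notinS]]] := IHn (ltnW lt_nT).
have: (0 < #|~: S|)%N by rewrite -(ltn_add2l #|S|) cardsC addn0 cardS.
case/card_gt0P => l0; rewrite finset.in_setC => l0S.
case: (@arg_maxP _ _ _ l0 [pred i | i \notin S] d l0S) => l /= lS lmax.
exists (l |: S)%SET, l; split.
- by rewrite cardsU1 lS cardS.
- move=> i /setU1P[-> //|iS]; exact: le_trans (notinS _ lS) (inS _ iS).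
- by move=> i; rewrite finset.in_setU1 negb_or => /andP[_]; exact: lmax.
Qed.

(** If [f] is pointwise the attained minimum over [k], the two minima commute
    because [c k] is finite, so that adding it commutes with [mine] and fixes
    the value [+oo] of an empty minimum; no separate case for empty [X]. *)
Lemma equivalent_indexed_program (R : realType) (T K : finType) (X : {set T})
    (f : T -> \bar R) (c : K -> R) (g : K -> T -> \bar R) :
  (forall x k, x \in X -> (f x <= (c k)%:E + g k x)%E) ->
  (forall x, x \in X -> exists k, f x = ((c k)%:E + g k x)%E) ->
  equivalent X (program X f) (indexed_program X (fun k => (c k)%:E) g).
Proof.
move=> f_le f_eq.
have same_value : opt_value (program X f) =
    opt_value (indexed_program X (fun k => (c k)%:E) g).
  have add_min (r : R) : {morph (fun y => r%:E + y)%E : y z / mine y z}.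
    by move=> y z /=; rewrite !minEle leeD2lE //; case: ifP.
  rewrite /=.
  under [RHS]eq_bigr => k _ do rewrite (big_morph _ (add_min _) (addey _)) //.
  rewrite exchange_big /=; apply: eq_bigr => x xX.
  apply/le_anti/andP; split.
    by apply: le_bigmin => [|k _]; [rewrite leey | exact: f_le].
  by have [k ->] := f_eq x xX; exact: bigmin_le_cond.
split=> // _ x xX; split=> [fx_opt|[k ck_opt]].
  have [k fxE] := f_eq x xX.
  by exists k; exact: etrans (esym fxE) (etrans fx_opt same_value).
have opt_eq : ((c k)%:E + g k x)%E = opt_value (program X f).
  exact: etrans ck_opt (esym same_value).
(* [f x] is squeezed between the optimum and the value at the index [k]. *)
apply/le_anti/andP; split; last exact: bigmin_le_cond.
by rewrite -[leRHS]/(opt_value (program X f)) -opt_eq f_le.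
Qed.

Lemma ereal_sup_scale (R : realType) (a e b : R) : 0 <= e -> 0 <= b ->
  ereal_sup [set (u * b)%:E | u in `[a, a + e]] = ((a + e) * b)%:E.
Proof.
move=> e_ge0 b_ge0; apply/le_anti/andP; split.
  apply: ge_ereal_sup => _ /= [u + <-]; rewrite in_itv /= => /andP[_ le_u].
  by rewrite lee_fin ler_wpM2r.
apply: ereal_sup_ubound; exists (a + e) => //=.
by rewrite in_itv /= lexx lerDl e_ge0.
Qed.

Lemma one_hot (n : nat) (r : 'I_n -> bool) :
  (\sum_(j < n) r j)%N = 1%N -> exists j0, forall j, r j = (j == j0).
Proof.
move=> /eqP/sum_nat_eq1[j0 [_ r1 r0]]; exists j0 => j.
have [->|/r0] := eqVneq j j0; first by case: (r j0) r1.
by case: (r j) => // /(_ isT).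
Qed.

Lemma block_row_colvec (R : realType) (m n : nat) (B : 'M[R]_(m, m * n))
    (x : 'M[bool]_(m, n)) (i : 'I_m) (j0 : 'I_n) :
  (forall i' j, i != i' -> B i (mxvec_index i' j) = 0) ->
  (forall j, x i j = (j == j0)) ->
  (B *m colvec R x) i ord0 = B i (mxvec_index i j0).
Proof.
move=> B_block xi; rewrite mxE (reindex _ (curry_mxvec_bij _ _)) /=.
rewrite (bigD1 (i, j0)) //= big1 => [|[i' j] /= neq].
  by rewrite addr0 !mxE mxvecE mxE xi eqxx mulr1.
rewrite !mxE mxvecE mxE.
have [ii'|/B_block->] := eqVneq i i'; last by rewrite mul0r.
by move: neq; rewrite -ii' xi xpair_eqE eqxx /= => /negPf->; rewrite mulr0.
Qed.

Lemma sum_F (R : realType) (m n : nat) (B : 'M[R]_(m, m * n)) (du : 'cV[R]_m)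
    (kl : option ('I_m * 'I_n)) (x : 'M[bool]_(m, n)) (j0 : 'I_m -> 'I_n) :
  (forall i j, x i j = (j == j0 i)) ->
  \sum_(ij : 'I_m * 'I_n) F B du ij.1 ij.2 kl x =
  \sum_i Num.max 0 (threshold B du (Some (i, j0 i)) - threshold B du kl).
Proof.
move=> xE; rewrite -(pair_bigA _ (fun i j => F B du i j kl x)) /=.
apply: eq_bigr => i _; rewrite (bigD1 (j0 i)) //= big1 ?addr0 => [|j].
  by rewrite /F xE eqxx mulr1.
by rewrite /F xE => /negPf->; rewrite mulr0.
Qed.

(** A deviating row contributes its nominal value plus [du_i * B_(i,(i,j0 i))]
    because the worst case is the upper end point; regrouping the nominal values
    leaves deviations that are literally thresholds, so that they can serve as
    the values of [t] in the minimization over index pairs. *)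
Lemma gamma_objective_term (R : realType) (m n : nat) (B : 'M[R]_(m, m * n))
    (ubar du : 'cV[R]_m) (x : 'M[bool]_(m, n)) (j0 : 'I_m -> 'I_n)
    (S : {set 'I_m}) :
  (forall i c, 0 <= B i c) ->
  (forall i i' j, i != i' -> B i (mxvec_index i' j) = 0) ->
  (forall i, 0 <= du i ord0) ->
  (forall i j, x i j = (j == j0 i)) ->
  (\sum_(i in S) ereal_sup
      [set (uncertain_fun B i x u)%:E | u in
         `[ubar i ord0, (ubar i ord0 + du i ord0)%R]]
   + \sum_(i in ~: S) (uncertain_fun B i x (ubar i ord0))%:E)%E =
  ((ubar^T *m B *m colvec R x) ord0 ord0
   + \sum_(i in S) threshold B du (Some (i, j0 i)))%:E.
Proof.
move=> B_ge0 B_block du_ge0 xE.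
have bE i : (B *m colvec R x) i ord0 = B i (mxvec_index i (j0 i)).
  by apply: block_row_colvec; [exact: B_block | exact: xE].
have fE i u : uncertain_fun B i x u = u * B i (mxvec_index i (j0 i)).
  by rewrite /uncertain_fun -row_mul mxE bE.
under eq_bigr => i _.
  under eq_imagel do rewrite fE.
  rewrite ereal_sup_scale // mulrDl.
  over.
under [X in (_ + X)%E]eq_bigr => i _ do rewrite fE.
rewrite !sumEFin -EFinD big_split /= addrAC; congr (_ + _)%:E.
rewrite -mulmxA mxE [RHS](bigID (mem S)) /=.
congr (_ + _); [|rewrite (eq_bigl (fun i => i \notin S))].
- by apply: eq_bigr => i _; rewrite [ubar^T _ _]mxE bE.
- by apply: eq_bigr => i _; rewrite [ubar^T _ _]mxE bE.
- by move=> i; rewrite inE.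
Qed.

Theorem corollary3p12 (R : realType) (m n : nat)
  (hm : (1 <= m)%N) (hn : (1 <= n)%N)
  (B : 'M[R]_(m, m * n))
  (B_ge0 : forall i c, 0 <= B i c)
  (B_block : forall (i i' : 'I_m) (j : 'I_n),
     i != i' -> B i (mxvec_index i' j) = 0)
  (ubar du : 'cV[R]_m)
  (du_ge0 : forall i, 0 <= du i ord0)
  (u_ge0 : forall i,
     [set` `[ubar i ord0, ubar i ord0 + du i ord0]] `<=` [set r : R | 0 <= r])
  (X : {set 'M[bool]_(m, n)})
  (X_sub : forall x, x \in X -> forall i, (\sum_(j < n) x i j)%N = 1%N)
  (Gamma : nat) (hGamma : (1 <= Gamma <= m)%N) :
  equivalent X
    (gamma_counterpart X (uncertain_fun B) ubar du Gamma)
    (reformulation B ubar du Gamma X).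
Proof.
have th_ge0 kl : 0 <= threshold B du kl.
  by case: kl => [[k l]|] //=; rewrite mulr_ge0.
have selection x : x \in X ->
    exists j0 : 'I_m -> 'I_n, forall i j, x i j = (j == j0 i).
  move=> /X_sub x1.
  by apply: (@fin_all_exists _ _ (fun i j0 => forall j, x i j = (j == j0))) => i;
    exact: one_hot (x1 i).
have upper x kl : x \in X ->
    (gamma_objective (uncertain_fun B) ubar du Gamma x <=
     (Gamma%:R * threshold B du kl)%:E +
     ((ubar^T *m B *m colvec R x) ord0 ord0 +
      \sum_(ij : 'I_m * 'I_n) F B du ij.1 ij.2 kl x)%:E)%E.
  move=> /selection[j0 xE]; rewrite (sum_F _ _ _ xE).
  apply: bigmax_le => [|S cardS]; first by rewrite leNye.
  rewrite (gamma_objective_term _ _ B_ge0 B_block du_ge0 xE).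
  rewrite -EFinD lee_fin addrCA lerD2l.
  exact: sum_le_threshold.
apply: equivalent_indexed_program => // x xX.
have [j0 xE] := selection x xX.
case/andP: hGamma => Gamma_gt0 le_Gamma.
have lt_Gamma : (Gamma.-1 < #|'I_m|)%N by rewrite card_ord prednK.
(* A largest sum of at most [Gamma] terms is reached on [Gamma] rows exactly,
   as thresholds are nonnegative; [Gamma >= 1] provides the separating row. *)
have [S [k [cardS inS notinS]]] :=
  separating_subset (fun i => threshold B du (Some (i, j0 i))) lt_Gamma.
rewrite prednK // in cardS.
exists (Some (k, j0 k)); apply/le_anti/andP; split; first exact: upper.
rewrite (sum_F _ _ _ xE) -EFinD addrCA -cardS -(sum_eq_threshold inS notinS).
rewrite -(gamma_objective_term ubar S B_ge0 B_block du_ge0 xE).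
by apply: (bigmax_sup S); rewrite ?cardS.
Qed.
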